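(* Let $q$ be odd and let $u,v,w\in\mathbb F_q[x]$ be monic quadratics such that $f=uvw$ is square-free of degree six and $\mathfrak d(u,v,w)=0$, and let $C$ be the smooth projective genus-2 curve $y^2=f(x)$ over $\mathbb F_q$. If the splitting class of $(u,v,w)$ is a nonsquare, then $\#C(\mathbb F_q)=q+1$.
   Context: For $u=x^2+u_1x+u_0$, $v=x^2+v_1x+v_0$, $w=x^2+w_1x+w_0$, $$\mathfrak d(u,v,w)=\det\begin{pmatrix} u_0 & u_1 & 1 \\ v_0 & v_1 & 1 \\ w_0 & w_1 & 1 \end{pmatrix}.$$ When $uvw$ is square-free and $\mathfrak d=0$, the splitting class is the class of $\operatorname{Res}(u,v)$ in $\mathbb F_q^\times/(\mathbb F_q^\times)^2$; it is the same for the pairs $(u,v),(v,w),(w,u)$. *)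

(* Defs.v *)
From HB Require Import structures.
From mathcomp Require Import all_boot all_order all_algebra.

Set Implicit Arguments.
Unset Strict Implicit.
Unset Printing Implicit Defensive.

Import GRing.Theory.
Local Open Scope ring_scope.

Definition monic_quadratic (F : fieldType) (p : {poly F}) : bool :=
  (p \is monic) && (size p == 3%N).

Definition square_free (F : fieldType) (p : {poly F}) : Prop :=
  p != 0 /\ forall g : {poly F}, g ^+ 2 %| p -> size g = 1%N.

(* Only meaningful on monic quadratics: the coefficients of 'X^2 are replaced
   by the literal 1. *)
Definition frak_d (F : fieldType) (u v w : {poly F}) : F :=
  \det (\matrix_(i < 3, j < 3)
          let p := [:: u; v; w]`_i in [:: p`_0; p`_1; 1]`_j).

(* For a != 0, this is the coset of a modulo the nonzero squares, i.e. the
   class of a in F^* / (F^* )^2. *)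
Definition square_class (F : finFieldType) (a : F) : {set F} :=
  [set a * c ^+ 2 | c : F & c != 0].

(* The pairs (v, w) and (w, u) define the same class when u * v * w is
   square-free and frak_d u v w = 0, so w does not occur in the formula. *)
Definition splitting_class (F : finFieldType) (u v w : {poly F}) : {set F} :=
  square_class (resultant u v).

Definition is_nonsquare_class (F : finFieldType) (A : {set F}) : bool :=
  A != square_class 1.

(* The smooth projective model of y^2 = f(x), for f square-free of degree 6 in
   odd characteristic, is the curve
     Y^2 = \sum_i f_i X^i Z^(6 - i)
   in the weighted projective plane with weights (1, 3, 1) for (X, Y, Z). It
   avoids the singular point (0 : 1 : 0), and on the complement of that point
   the rational points are the orbits of nonzero rational triples under
   (X, Y, Z) |-> (l X, l^3 Y, l Z) with l in F^*. *)
Definition sextic_form (F : fieldType) (f : {poly F}) (X Z : F) : F :=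
  \sum_(i < 7) f`_i * X ^+ i * Z ^+ (6 - i).

Definition curve_cone (F : finFieldType) (f : {poly F}) : {set F * F * F} :=
  [set P | (P != (0, 0, 0)) &&
           (let: (X, Y, Z) := P in Y ^+ 2 == sextic_form f X Z)].

Definition weighted_equiv (F : finFieldType) : rel (F * F * F) :=
  fun P Q => let: (X, Y, Z) := P in
    [exists l : F, (l != 0) && (Q == (l * X, l ^+ 3 * Y, l * Z))].

Definition curve_points (F : finFieldType) (f : {poly F}) :
    {set {set F * F * F}} :=
  equivalence_partition (@weighted_equiv F) (curve_cone f).

(* Main.v *)
Require Import Defs.
From HB Require Import structures.
From mathcomp Require Import all_boot all_order all_algebra.
From mathcomp Require Import ring.

Set Implicit Arguments.
Unset Strict Implicit.
Unset Printing Implicit Defensive.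

Import GRing.Theory.
Local Open Scope ring_scope.

(** The condition [frak_d u v w = 0] says that u, v, w lie in one pencil of
    quadratics. The pencil spanned by u and v defines a degree-2 map u/v from
    the projective line to itself, whose deck transformation is an involution
    of the line, induced by a trace-zero linear map M of the plane of pairs
    P = (X, Z). With the 2 x 2 minors of the coefficients of u and v as the
    entries of M, and r := Res(u, v), one finds
      - M^2 is multiplication by r ([pencil_involutionK]), so that M is
        invertible, r being nonzero for coprime u and v,
      - U (M P) = r * U P for the form U of any member of the pencil
        ([quad_form_involution]).
    The sextic form f of u * v * w therefore satisfies f (M P) = r^3 * f P.
    When r is not a square, neither is r^3, and then f P and r^3 * f P have
    exactly two square roots between them ([card_sqrts_twist]). So a point of
    the line carries one point of the curve on average over P and M P, and the
    curve has as many rational points as the line. To avoid choosing charts,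
    this count is done on the cone over the curve, on which F^* acts freely
    ([card_curve_points_twist]). *)

(** * Counting square roots *)

Section SquareRoots.
Variable F : finFieldType.

Definition sqrts (t : F) : {set F} := [set y | y ^+ 2 == t].
Arguments sqrts t%_R.

Lemma card_sqrts_le2 (t : F) : (#|sqrts t| <= 2)%N.
Proof.
have [->|[y]] := set_0Vmem (sqrts t); first by rewrite cards0.
rewrite inE => /eqP yt.
have : sqrts t \subset [set y; - y].
  by apply/subsetP=> z; rewrite !inE -yt eqf_sqr.
by move/subset_leq_card/leq_trans; apply; rewrite cards2; case: eqP.
Qed.

Lemma sum_card_sqrts : (\sum_(t : F) #|sqrts t| = #|F|)%N.
Proof.
have -> : #|F| = (\sum_(y : F) 1)%N by rewrite sum1_card.
rewrite [RHS](partition_big (fun y : F => y ^+ 2) predT) //=.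
by apply: eq_bigr => t _; rewrite -sum1_card; apply: eq_bigl => y; rewrite inE.
Qed.

(** At most one of t and d * t has square roots when t != 0, and 0 has a single
    one, so the sum is at most 2. Summed over t it equals 2q, because each of t and d * t runs over
    the whole field; hence the bound is attained everywhere. *)
Lemma card_sqrts_twist (d : F) : (forall c, d != c ^+ 2) ->
  forall t, (#|sqrts t| + #|sqrts (d * t)| = 2)%N.
Proof.
move=> dns; have d0 : d != 0 by have := dns 0; rewrite expr0n.
have le2 t : (#|sqrts t| + #|sqrts (d * t)| <= 2)%N.
  have [->|t0] := eqVneq t 0.
    have -> : sqrts (d * 0) = [set 0].
      by apply/setP=> y; rewrite !inE mulr0 sqrf_eq0.
    have -> : sqrts 0 = [set 0] by apply/setP=> y; rewrite !inE sqrf_eq0.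
    by rewrite cards1.
  have [->|[y]] := set_0Vmem (sqrts t).
    by rewrite cards0 add0n card_sqrts_le2.
  rewrite inE => /eqP yt.
  rewrite [X in (_ + X)%N]eq_card0 ?addn0 ?card_sqrts_le2 // => z.
  apply/negP; rewrite /= inE -yt => /eqP zt.
  have y0 : y != 0 by apply: contra_neq t0 => y0; rewrite -yt y0 expr0n.
  have /eqP := dns (z / y); apply.
  by rewrite expr_div_n zt mulfK // sqrf_eq0.
have := leqif_sum (fun t (_ : predT t) => leqif_eq (le2 t)).
have twist : (\sum_t #|sqrts (d * t)| = \sum_t #|sqrts t|)%N.
  by rewrite [RHS](reindex_inj (mulfI d0)).
rewrite big_split /= twist sum_card_sqrts sum_nat_const muln2 addnn.
move=> /leqif_refl/forallP h t.
exact/eqP/(implyP (h t)).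
Qed.

(** * From the cone to the curve *)

Lemma sextic_form_scale (f : {poly F}) (l X Z : F) :
  sextic_form f (l * X) (l * Z) = l ^+ 6 * sextic_form f X Z.
Proof.
rewrite /sextic_form mulr_sumr; apply: eq_bigr => i _.
have {1}-> : l ^+ 6 = l ^+ i * l ^+ (6 - i) by rewrite -exprD subnKC // -ltnS.
by rewrite !exprMn; ring.
Qed.

Lemma sextic_form00 (f : {poly F}) : sextic_form f 0 0 = 0.
Proof.
apply: big1 => -[[|i] /= lti] _.
  by rewrite subn0 [0 ^+ 6]expr0n mulr0.
by rewrite [0 ^+ i.+1]expr0n mulr0 mul0r.
Qed.

Lemma curve_coneP (f : {poly F}) (X Y Z : F) :
  ((X, Y, Z) \in curve_cone f) =
    ((X, Z) != (0, 0)) && (Y \in sqrts (sextic_form f X Z)).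
Proof.
rewrite !inE; case: (Y ^+ 2 =P _) => [Y2|]; rewrite ?andbF // !andbT.
congr (~~ _); rewrite !xpair_eqE; case: (X =P 0) => //= X0.
case: (Z =P 0) => [Z0|]; rewrite ?andbF // andbT.
by rewrite -sqrf_eq0 Y2 X0 Z0 sextic_form00 eqxx.
Qed.

Lemma card_curve_cone (f : {poly F}) :
  #|curve_cone f| =
    (\sum_(P : F * F | P != (0, 0)%R) #|sqrts (sextic_form f P.1 P.2)|)%N.
Proof.
rewrite -sum1_card.
rewrite (partition_big (fun P => (P.1.1, P.2)) (fun P => P != (0, 0))) /=;
  last by move=> [[X Y] Z]; rewrite curve_coneP => /andP[].
apply: eq_bigr => -[X Z] nz /=.
have inj : injective (fun Y : F => (X, Y, Z)) by move=> Y Y' [].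
rewrite -(card_imset _ inj) -sum1_card; apply: eq_bigl => -[[X' Y] Z'] /=.
apply/andP/imsetP => [[h /eqP[eX eZ]]|[Y' hY [-> -> ->]]].
  by move: h; rewrite curve_coneP eX eZ => /andP[_ h]; exists Y.
by rewrite eqxx curve_coneP nz.
Qed.

Lemma weighted_equiv_rel : equivalence_rel (@weighted_equiv F).
Proof.
have sym : symmetric (@weighted_equiv F).
  apply: symmetric_from_pre => -[[X Y] Z] [[X' Y'] Z'].
  move=> /existsP[l /andP[l0 /eqP[-> -> ->]]].
  apply/existsP; exists l^-1; rewrite invr_eq0 l0.
  by apply/eqP; congr (_, _, _); field.
apply/equivalence_relP; split.
  move=> [[X Y] Z]; apply/existsP; exists 1.
  by rewrite oner_eq0 expr1n !mul1r eqxx.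
have trans : transitive (@weighted_equiv F).
  move=> [[X' Y'] Z'] [[X Y] Z] [[X1 Y1] Z1].
  move=> /existsP[l /andP[l0 /eqP[-> -> ->]]].
  move=> /existsP[m /andP[m0 /eqP[-> -> ->]]].
  by apply/existsP; exists (m * l); rewrite mulf_neq0 //= exprMn !mulrA.
by move=> P Q PQ R; apply: (left_trans sym trans).
Qed.

(** A point of the cone has X or Z nonzero, so F^* acts freely on it. *)
Lemma card_weighted_orbit (f : {poly F}) (P : F * F * F) :
  P \in curve_cone f ->
  #|[set Q in curve_cone f | weighted_equiv P Q]| = #|F|.-1.
Proof.
case: P => [[X Y] Z]; rewrite curve_coneP => /andP[nz hY].
rewrite -(cardsC1 (0 : F)).
have inj : injective (fun l : F => (l * X, l ^+ 3 * Y, l * Z)).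
  move=> l m [eX _ eZ]; move: nz; rewrite xpair_eqE negb_and => /orP[n0|n0].
    exact: mulIf eX.
  exact: mulIf eZ.
rewrite -(card_imset _ inj); apply: eq_card => Q; rewrite inE.
apply/andP/imsetP => [[_ /existsP[l /andP[l0 /eqP->]]]|[l l_nz ->]].
  by exists l; rewrite ?inE.
have l0 : l != 0 by move: l_nz; rewrite !inE.
split; last by apply/existsP; exists l; rewrite l0 /=.
rewrite curve_coneP !xpair_eqE !mulf_eq0 (negPf l0) -xpair_eqE nz.
move: hY; rewrite !inE sextic_form_scale exprMn -exprM => /eqP->.
exact: eqxx.
Qed.

Lemma card_curve_cone_points (f : {poly F}) :
  #|curve_cone f| = (#|curve_points f| * #|F|.-1)%N.
Proof.
apply: card_uniform_partition; last first.
  by apply: equivalence_partitionP => x y z _ _ _; apply: weighted_equiv_rel.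
by move=> A /imsetP[P Pf ->]; apply: card_weighted_orbit.
Qed.

(** The twisting hypothesis pairs the fibres over P and T P: together they
    have two elements. Reindexing the count of the cone along T therefore
    shows that the average size of a fibre is 1. *)
Lemma card_curve_points_twist (f : {poly F}) (d : F) (T : F * F -> F * F) :
    (forall c, d != c ^+ 2) -> injective T -> T (0, 0) = (0, 0) ->
    (forall P, sextic_form f (T P).1 (T P).2 = d * sextic_form f P.1 P.2) ->
  #|curve_points f| = (#|F| + 1)%N.
Proof.
move=> dns injT T0 fT; have F1 := card_finNzRing_gt1 F.
have dbl : (#|curve_cone f|.*2 = (#|F| ^ 2).-1.*2)%N.
  rewrite -addnn {2}card_curve_cone (reindex_inj injT) /=.
  rewrite (eq_bigl (fun P => P != (0, 0))); last first.
    by move=> P; rewrite -{1}T0 (inj_eq injT).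
  rewrite card_curve_cone -big_split /=.
  rewrite (eq_bigr (fun=> 2)); last first.
    by move=> P _; rewrite fT card_sqrts_twist.
  rewrite sum_nat_const muln2; congr (_.*2).
  by rewrite -[RHS]/(#|F| * #|F|).-1 -card_prod -(cardC1 (0, 0)).
have cone : #|curve_cone f| = (#|F| ^ 2).-1 by apply: double_inj.
apply/eqP; rewrite -(eqn_pmul2r (_ : 0 < #|F|.-1)%N) -?card_curve_cone_points.
  by rewrite cone -!subn1 mulnC -subn_sqr.
by rewrite -ltnS prednK // (ltn_trans _ F1).
Qed.

End SquareRoots.

(** * Homogenised quadratics *)

Section Quadratics.
Variable F : fieldType.

Definition quad_form (p : {poly F}) (X Z : F) : F :=
  X ^+ 2 + p`_1 * X * Z + p`_0 * Z ^+ 2.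

Lemma monic_quadratic_coef2 (p : {poly F}) : monic_quadratic p -> p`_2 = 1.
Proof. by move=> /andP[/monicP pm /eqP sp]; rewrite -pm lead_coefE sp. Qed.

Lemma horner_monic_quadratic (p : {poly F}) (x : F) : monic_quadratic p ->
  p.[x] = quad_form p x 1.
Proof.
move=> pq; have /andP[_ /eqP sp] := pq.
rewrite (@horner_coef_wide _ 3) ?sp // !big_ord_recl big_ord0 /=.
by rewrite (monic_quadratic_coef2 pq) /quad_form /bump /=; ring.
Qed.

(** Off Z = 0 both sides are Z^6 times the value of the polynomial at X / Z;
    on Z = 0 only the leading coefficients survive. *)
Lemma sextic_form_prod (u v w : {poly F}) (X Z : F) :
    monic_quadratic u -> monic_quadratic v -> monic_quadratic w ->
  sextic_form (u * v * w) X Z =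
    quad_form u X Z * quad_form v X Z * quad_form w X Z.
Proof.
move=> uq vq wq.
have [um /eqP su] := andP uq; have [vm /eqP sv] := andP vq.
have [wm /eqP sw] := andP wq.
have sf : size (u * v * w) = 7%N.
  by rewrite !size_monicM ?monic_neq0 ?monicMl ?su ?sv ?sw.
have fm : u * v * w \is monic by rewrite !monicMl.
have [->|Z0] := eqVneq Z 0.
  rewrite /sextic_form big_ord_recr big1 /=; last first.
    by move=> i _; rewrite [0 ^+ _]expr0n subn_eq0 leqNgt ltn_ord mulr0.
  have -> : (u * v * w)`_6 = 1 by rewrite -(monicP fm) lead_coefE sf.
  by rewrite /quad_form subnn expr0; ring.
transitivity (Z ^+ 6 * (u * v * w).[X / Z]).
  rewrite (@horner_coef_wide _ 7) ?sf // mulr_sumr; apply: eq_bigr => i _.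
  have -> : Z ^+ 6 = Z ^+ i * Z ^+ (6 - i) by rewrite -exprD subnKC // -ltnS.
  rewrite expr_div_n; field.
  by rewrite expf_neq0.
by rewrite !hornerM !horner_monic_quadratic // /quad_form; field.
Qed.

Lemma resultant_quadratic (u v : {poly F}) :
    monic_quadratic u -> monic_quadratic v ->
  resultant u v =
    (v`_0 - u`_0) ^+ 2 + (u`_1 * v`_0 - u`_0 * v`_1) * (u`_1 - v`_1).
Proof.
move=> uq vq; have [_ /eqP su] := andP uq; have [_ /eqP sv] := andP vq.
have u2 := monic_quadratic_coef2 uq; have v2 := monic_quadratic_coef2 vq.
have [u3 v3] : u`_3 = 0 /\ v`_3 = 0 by rewrite !nth_default ?su ?sv.
(* The dimension of the Sylvester matrix depends on size u and size v; making
   it variable allows it to be replaced by 2 + 2. *)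
have det4 n m (A : 'M[F]_(n + m)) : n = 2%N -> m = 2%N ->
    (forall i j, A i j =
       let S_ (r : {poly F}) (k : nat) := r`_(j - k) *+ (k <= j)%N in
       if (i < 2)%N then S_ u i else S_ v (i - 2)%N) ->
    \det A =
      (v`_0 - u`_0) ^+ 2 + (u`_1 * v`_0 - u`_0 * v`_1) * (u`_1 - v`_1).
  move=> en em; subst n m => AE.
  do 3! rewrite !(expand_det_row _ ord0) !big_ord_recl !big_ord0 /cofactor.
  rewrite !det_mx11 !mxE !AE /= /bump /= ?(u2, v2, u3, v3).
  by ring.
apply: det4; rewrite ?su ?sv // => i j; rewrite Sylvester_mxE /=.
case: splitP => k /= ->; last first.
  have -> : ((size v).-1 + k = 2 + k)%N by rewrite sv.
  by rewrite ltnNge leq_addr /= addKn.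
by have -> : (k < 2)%N by apply: leq_trans (ltn_ord k) _; rewrite sv.
Qed.

(** * The involution of a pencil *)

Lemma square_free_resultant (u v w : {poly F}) :
  square_free (u * v * w) -> resultant u v != 0.
Proof.
move=> [_ sqf]; rewrite resultant_eq0 -leqNgt (sqf (gcdp u v)) //.
by rewrite expr2 dvdp_mulr // dvdp_mul ?dvdp_gcdl ?dvdp_gcdr.
Qed.

(** The deck transformation of u / v, lifted to the plane. Its fixed form
    c X^2 - 2 a X Z - b Z^2 is, up to sign, the Jacobian u' v - u v', which
    vanishes where u / v ramifies. *)
Definition pencil_involution (u v : {poly F}) (P : F * F) : F * F :=
  let a := v`_0 - u`_0 in
  let b := u`_1 * v`_0 - u`_0 * v`_1 in
  let c := u`_1 - v`_1 in
  (a * P.1 + b * P.2, c * P.1 - a * P.2).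

Lemma pencil_involutionK (u v : {poly F}) (P : F * F) :
    monic_quadratic u -> monic_quadratic v ->
  pencil_involution u v (pencil_involution u v P) =
    (resultant u v * P.1, resultant u v * P.2).
Proof.
by move=> uq vq; rewrite resultant_quadratic //; congr (_, _) => /=; ring.
Qed.

Lemma frak_dE (u v w : {poly F}) :
  frak_d u v w = u`_0 * (v`_1 - w`_1) - u`_1 * (v`_0 - w`_0)
                 + (v`_0 * w`_1 - v`_1 * w`_0).
Proof.
rewrite /frak_d.
do 2! rewrite !(expand_det_row _ ord0) !big_ord_recl !big_ord0 /cofactor.
by rewrite !det_mx11 !mxE /= /bump /=; ring.
Qed.

(** The difference of the two sides is [frak_d u v w] times J, the fixed form
    of the involution. *)
Lemma quad_form_involution (u v w : {poly F}) (P : F * F) :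
    monic_quadratic u -> monic_quadratic v -> frak_d u v w = 0 ->
  let Q := pencil_involution u v P in
  quad_form w Q.1 Q.2 = resultant u v * quad_form w P.1 P.2.
Proof.
move=> uq vq; rewrite resultant_quadratic // => d0 /=.
rewrite /quad_form; apply/eqP; rewrite -subr_eq0; apply/eqP.
set J := (u`_1 - v`_1) * P.1 ^+ 2 - 2 * (v`_0 - u`_0) * P.1 * P.2
         - (u`_1 * v`_0 - u`_0 * v`_1) * P.2 ^+ 2.
transitivity (frak_d u v w * J); last by rewrite d0 mul0r.
by rewrite frak_dE /J; ring.
Qed.

End Quadratics.

Lemma nonsquare_class (F : finFieldType) (a c : F) :
  a != 0 -> is_nonsquare_class (square_class a) -> a != c ^+ 2.
Proof.
move=> a0; apply: contra_neq => ac.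
have c0 : c != 0 by apply: contra_neq a0 => c0; rewrite ac c0 expr0n.
apply/setP=> x; apply/imsetP/imsetP => -[y /[!inE] y0 ->].
  by exists (c * y); rewrite ?inE ?mulf_neq0 // ac mul1r exprMn.
by exists (y / c); rewrite ?inE ?mulf_neq0 ?invr_eq0 // ac; field.
Qed.

Theorem corollary8p12 (F : finFieldType) (u v w : {poly F})
    (q_odd : odd #|F|)
    (u_quad : monic_quadratic u)
    (v_quad : monic_quadratic v)
    (w_quad : monic_quadratic w)
    (f_sqfree : square_free (u * v * w))
    (f_deg6 : size (u * v * w) = 7%N)
    (d_eq0 : frak_d u v w = 0)
    (nonsquare : is_nonsquare_class (splitting_class u v w)) :
  #|curve_points (u * v * w)| = (#|F| + 1)%N.
Proof.
have r0 := square_free_resultant f_sqfree.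
apply: (@card_curve_points_twist _ _ (resultant u v ^+ 3)
          (pencil_involution u v)).
(* A square root c of r^3 gives the square root c / r of r. *)
- move=> c; apply/eqP => r3.
  have /eqP[] := nonsquare_class (c / resultant u v) r0 nonsquare.
  by rewrite expr_div_n -r3; field.
- move=> P Q /(congr1 (pencil_involution u v)).
  rewrite !pencil_involutionK // => -[/(mulfI r0) e1 /(mulfI r0) e2].
  by rewrite [P]surjective_pairing e1 e2 -surjective_pairing.
- by rewrite /pencil_involution /= !mulr0 addr0 subr0.
(* u and v belong to the pencil as well. *)
move=> P; have duu : frak_d u v u = 0 by rewrite frak_dE; ring.
have duv : frak_d u v v = 0 by rewrite frak_dE; ring.
rewrite !sextic_form_prod // !quad_form_involution //; ring.
Qed.
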